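(* Let $(M,\eta,\xi,g,\Phi)$ be a Lorentzian Sasakian $3$-manifold and let $\alpha:I\to M$ be a non-geodesic magnetic whirl curve, i.e. a non-geodesic Frenet curve that is both a magnetic trajectory of the contact magnetic field of some strength $q\neq0$ and a contact whirl curve. Then the torsion of $\alpha$ is $\tau=1$.
   Context: A contact metric Lorentzian $3$-manifold $(M,\eta,\xi,g,\Phi)$ is a smooth $3$-manifold with a contact form $\eta$, Reeb vector field $\xi$ ($\eta(\xi)=1$, $d\eta(\xi,\cdot)=0$), a Lorentzian metric $g$ with $g(\xi,\xi)=-1$, and a $(1,1)$-tensor $\Phi$ with $\Phi^2=-\mathrm{id}+\eta\otimes\xi$, $g(\Phi X,\Phi Y)=g(X,Y)+\eta(X)\eta(Y)$ and $d\eta(X,Y)=g(X,\Phi Y)$, where $d\eta(X,Y)=\tfrac12\bigl(X\eta(Y)-Y\eta(X)-\eta([X,Y])\bigr)$. In particular $\eta(X)=-g(X,\xi)$, $\eta\circ\Phi=0$, and, with $\nabla$ the Levi-Civita connection of $g$ and $h=\frac12\mathcal L_\xi\Phi$, one has $\nabla_X\xi=\Phi X-\Phi hX$. It is Lorentzian Sasakian if $\xi$ is Killing (equivalently $h=0$); then $\nabla_X\xi=\Phi X$ and $(\nabla_X\Phi)Y=g(X,Y)\xi+\eta(Y)X$. The vector product is $X\wedge Y=g(X,\Phi Y)\xi-\eta(Y)\Phi X+\eta(X)\Phi Y$. A (non-geodesic) Frenet curve is a unit-speed non-null curve $\alpha$, with $T=\alpha'$ and $g(T,T)=\varepsilon_1\in\{\pm1\}$,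 such that $\nabla_TT$ is non-null. It has an orthonormal Frenet frame $\{T,N,B\}$, with $g(N,N)=\varepsilon_2$, $g(B,B)=\varepsilon_3$, $\varepsilon_1\varepsilon_2=-\varepsilon_3$, oriented so that $T\wedge N=\varepsilon_3B$, $N\wedge B=\varepsilon_1T$, $B\wedge T=\varepsilon_2N$, and satisfying $$\nabla_TT=\varepsilon_2\kappa N,\quad \nabla_TN=-\varepsilon_1\kappa T-\varepsilon_3\tau B,\quad \nabla_TB=\varepsilon_2\tau N,$$ with curvature $\kappa>0$ and torsion $\tau$. It is a contact whirl curve if there is a constant $\varrho\neq0$ with $\eta(T)=\varrho\,\eta(N)$ along $\alpha$. For $q\neq0$, the contact magnetic field of strength $q$ is the closed $2$-form $F_{\xi,q}=-q\,d\eta$. Its Lorentz force, the $(1,1)$-tensor $\varphi$ with $g(\varphi(X),Y)=F_{\xi,q}(X,Y)$, is $\varphi=q\Phi$. A magnetic trajectory is a curve satisfying $\nabla_TT=\varphi(T)$, i.e. $\nabla_TT=q\,\Phi T$. *)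

(* Defs.v *)
From mathcomp Require Import all_boot all_order all_algebra.
From mathcomp Require Import all_classical all_reals all_analysis.
From mathcomp Require Import ring.

Set Implicit Arguments.
Unset Strict Implicit.
Unset Printing Implicit Defensive.

Import Order.TTheory GRing.Theory Num.Theory.
Import numFieldNormedType.Exports.

Local Open Scope classical_set_scope.
Local Open Scope ring_scope.

(* Tangent vectors are represented by their components in a chart, written as
   row vectors.  A one-form has a column vector w of components, with value
   X *m w on X; a bilinear form has a matrix A, with value X *m A *m Y^T on
   (X, Y); an endomorphism has a matrix P, with value X *m P on X.  Tensor
   fields are families of components indexed by the charts of the atlas that
   obey the usual transformation law on overlaps. *)

(* On an open set U, [C_on k U f] says that f is of class C^k. *)
Fixpoint C_on (R : realType) (V W : normedModType R) (k : nat)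
    (U : set V) (f : V -> W) : Prop :=
  match k with
  | 0 => forall x, U x -> {for x, continuous f}
  | k'.+1 => (forall x, U x -> differentiable f x) /\
             (forall v, C_on k' U ('D_v f))
  end.

Definition smooth_on (R : realType) (V W : normedModType R)
    (U : set V) (f : V -> W) : Prop := forall k, C_on k U f.

Record chart (R : realType) (n : nat) (M : topologicalType) := Chart {
  dom : set M;
  coord :> M -> 'rV[R]_n;
  icoord : 'rV[R]_n -> M;
  dom_open : open dom;
  codom_open : open (coord @` dom);
  coordK : forall p, dom p -> icoord (coord p) = p;
  coord_cont : {within dom, continuous coord};
  icoord_cont : {within coord @` dom, continuous icoord}
}.

Record manifold (R : realType) (n : nat) := Manifold {
  carrier :> topologicalType;
  carrier_hausdorff : hausdorff_space carrier;
  carrier_second_countable : @second_countable carrier;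
  atlas : Type;
  chart_of : atlas -> chart R n carrier;
  atlas_cover : forall p, exists c, dom (chart_of c) p;
  atlas_smooth : forall c d,
    smooth_on (chart_of c @` (dom (chart_of c) `&` dom (chart_of d)))
              (chart_of d \o icoord (chart_of c))
}.

Coercion chart_of : atlas >-> chart.

Section ManifoldDefs.
Variables (R : realType) (n : nat) (M : manifold R n).
Implicit Types (c d : atlas M) (p : M).

(* With row vectors, the components of a tangent vector at p in the charts c
   and d are related by X_d = X_c *m transition_mx c d p. *)
Definition transition_mx c d p : 'M[R]_n := 'J (d \o icoord c) (c p).

(* The i-th coordinate partial derivative of f in the chart c. *)
Definition pderiv (V : normedModType R) c (i : 'I_n) (f : M -> V) p : V :=
  'D_(delta_mx 0 i) (f \o icoord c) (c p).

(* [law J v w] relates the components v in one chart to the components w in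
   another one, J being the transition matrix from the former to the latter. *)
Record tensor_field (V : normedModType R)
    (law : 'M[R]_n -> V -> V -> Prop) := TensorField {
  components :> atlas M -> M -> V;
  comp_law : forall c d p, dom c p -> dom d p ->
    law (transition_mx c d p) (components c p) (components d p);
  comp_smooth : forall c,
    smooth_on (c @` dom c) (components c \o icoord c)
}.

Definition vector_field :=
  @tensor_field 'rV[R]_n (fun J X X' => X' = X *m J).
Definition one_form :=
  @tensor_field 'cV[R]_n (fun J w w' => w = J *m w').
Definition bilinear_field :=
  @tensor_field 'M[R]_n (fun J A A' => A = J *m A' *m J^T).
Definition endo_field :=
  @tensor_field 'M[R]_n (fun J P P' => P *m J = J *m P').

End ManifoldDefs.

Definition eval1 (R : realType) (n : nat) (w : 'cV[R]_n) (X : 'rV[R]_n) : R :=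
  (X *m w) 0 0.
Definition eval2 (R : realType) (n : nat) (A : 'M[R]_n) (X Y : 'rV[R]_n) : R :=
  (X *m A *m Y^T) 0 0.

Section TensorCalculus.
Variables (R : realType) (n : nat) (M : manifold R n).
Implicit Types (c d : atlas M) (p : M).

(* (ext_d w)(X, Y) = (X w(Y) - Y w(X) - w([X, Y])) / 2; note the factor 1/2. *)
Definition ext_d (w : one_form M) c p : 'M[R]_n :=
  \matrix_(i, j) (2^-1 * (pderiv c i (fun x => w c x j 0) p
                          - pderiv c j (fun x => w c x i 0) p)).

Definition lorentzian (g : bilinear_field M) : Prop :=
  forall c p, dom c p ->
    (g c p)^T = g c p /\
    exists2 P : 'M[R]_n, P \in unitmx &
      P *m g c p *m P^T = diag_mx (\row_i (if (i : nat) == 0%N then -1 else 1)).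

(* The Lie derivative of g along the vector field X. *)
Definition lie_metric (X : vector_field M) (g : bilinear_field M) c p : 'M[R]_n :=
  \matrix_(i, j)
    \sum_k (X c p 0 k * pderiv c k (fun x => g c x i j) p
            + g c p k j * pderiv c i (fun x => X c x 0 k) p
            + g c p i k * pderiv c j (fun x => X c x 0 k) p).

Definition killing (g : bilinear_field M) (X : vector_field M) : Prop :=
  forall c p, dom c p -> lie_metric X g c p = 0.

(* The components of nabla_(d_i) d_j for the Levi-Civita connection of g; see
   [christoffelC] and [christoffel_metric]. *)
Definition christoffel (g : bilinear_field M) c p (i j : 'I_n) : 'rV[R]_n :=
  (\row_l (2^-1 * (pderiv c i (fun x => g c x j l) p
                   + pderiv c j (fun x => g c x i l) p
                   - pderiv c l (fun x => g c x i j) p)))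
  *m invmx (g c p).

Record curve := Curve {
  curve_dom : set R;
  curve_dom_open : open curve_dom;
  curve_dom_interval : is_interval curve_dom;
  curve_pt :> R -> M;
  curve_cont : forall t, curve_dom t -> {for t, continuous curve_pt};
  curve_smooth : forall c,
    @smooth_on R R 'rV[R]_n (curve_dom `&` curve_pt @^-1` dom c) (c \o curve_pt)
}.

Record vector_along (a : curve) := VectorAlong {
  along :> atlas M -> R -> 'rV[R]_n;
  along_law : forall c d t, curve_dom a t -> dom c (a t) -> dom d (a t) ->
    along d t = along c t *m transition_mx c d (a t);
  along_smooth : forall c,
    @smooth_on R R 'rV[R]_n (curve_dom a `&` a @^-1` dom c) (along c)
}.

Definition velocity (a : curve) c (t : R) : 'rV[R]_n := derive1 (c \o a) t.

(* The covariant derivative nabla_T Y, where T is the velocity of a. *)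
Definition cov_deriv (g : bilinear_field M) (a : curve)
    (Y : atlas M -> R -> 'rV[R]_n) c (t : R) : 'rV[R]_n :=
  derive1 (Y c) t +
  \sum_i \sum_j (velocity a c t 0 i * Y c t 0 j) *: christoffel g c (a t) i j.

Definition lorentz_force (g : bilinear_field M)
    (F : atlas M -> M -> 'M[R]_n) (phi : endo_field M) : Prop :=
  forall c p, dom c p -> forall X Y : 'rV[R]_n,
    eval2 (g c p) (X *m phi c p) Y = eval2 (F c p) X Y.

Definition magnetic_trajectory (g : bilinear_field M)
    (F : atlas M -> M -> 'M[R]_n) (a : curve) : Prop :=
  exists2 phi : endo_field M, lorentz_force g F phi &
    forall c t, curve_dom a t -> dom c (a t) ->
      cov_deriv g a (velocity a) c t = velocity a c t *m phi c (a t).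

End TensorCalculus.

Section ChristoffelFacts.
Variables (R : realType) (n : nat) (M : manifold R n) (g : bilinear_field M).
Implicit Types (c : atlas M) (p : M).

Lemma lorentzian_unitmx c p : lorentzian g -> dom c p -> g c p \in unitmx.
Proof.
move=> g_lor /g_lor[_ [P Pu PgP]].
have : P *m g c p *m P^T \in unitmx.
  rewrite PgP unitmxE det_diag unitfE; apply/prodf_neq0 => i _.
  by rewrite mxE; case: ifP => _; rewrite ?oppr_eq0 oner_neq0.
by rewrite !unitmx_mul => /andP[/andP[]].
Qed.

Lemma pderiv_metric_sym c p (k i j : 'I_n) : lorentzian g -> dom c p ->
  pderiv c k (fun x => g c x i j) p = pderiv c k (fun x => g c x j i) p.
Proof.
move=> g_lor cp; apply: near_eq_derive.
have Mcp : (c @` dom c) (c p) by exists p.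
near=> y.
have [q cq <-] : (c @` dom c) y.
  by near: y; apply: open_nbhs_nbhs; split=> //; exact: codom_open.
by rewrite /= coordK //; have [/matrixP/(_ i j)] := g_lor _ _ cq; rewrite mxE.
Unshelve. all: by end_near.
Qed.

Lemma christoffelC c p (i j : 'I_n) : lorentzian g -> dom c p ->
  christoffel g c p i j = christoffel g c p j i.
Proof.
move=> g_lor cp; rewrite /christoffel; congr (_ *m _); apply/rowP => l.
by rewrite !mxE (pderiv_metric_sym l i j g_lor cp) [X in X - _]addrC.
Qed.

Lemma christoffel_metric c p (k i j : 'I_n) : lorentzian g -> dom c p ->
  pderiv c k (fun x => g c x i j) p =
    eval2 (g c p) (christoffel g c p k i) (delta_mx 0 j)
    + eval2 (g c p) (delta_mx 0 i) (christoffel g c p k j).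
Proof.
move=> g_lor cp.
have gu := lorentzian_unitmx g_lor cp; have [gT _] := g_lor _ _ cp.
have E u v : eval2 (g c p) u v = eval2 (g c p) v u.
  rewrite /eval2 -[in LHS](trmxK (u *m _ *m _)) mxE.
  by rewrite !trmx_mul trmxK gT mulmxA.
rewrite [X in _ + X]E /eval2 /christoffel !mulmxKV // !trmx_delta -!colE !mxE.
rewrite (pderiv_metric_sym k j i g_lor cp).
by field.
Qed.

End ChristoffelFacts.

Record contact_metric_lorentzian (R : realType) (M : manifold R 3) :=
  ContactMetricLorentzian {
  eta : one_form M;
  xi : vector_field M;
  metric : bilinear_field M;
  Phi : endo_field M;
  (* (eta /\ d eta)(X, Y, Z) is, up to a constant factor, the cyclic sum. *)
  eta_contact : forall (c : atlas M) p, dom c p -> exists X Y Z : 'rV[R]_3,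
    eval1 (eta c p) X * eval2 (ext_d eta c p) Y Z
    + eval1 (eta c p) Y * eval2 (ext_d eta c p) Z X
    + eval1 (eta c p) Z * eval2 (ext_d eta c p) X Y != 0;
  eta_xi : forall (c : atlas M) p, dom c p -> eval1 (eta c p) (xi c p) = 1;
  deta_xi : forall (c : atlas M) p, dom c p -> forall X : 'rV[R]_3,
    eval2 (ext_d eta c p) (xi c p) X = 0;
  metric_lorentzian : lorentzian metric;
  metric_xi : forall (c : atlas M) p, dom c p ->
    eval2 (metric c p) (xi c p) (xi c p) = -1;
  Phi_sqr : forall (c : atlas M) p, dom c p -> forall X : 'rV[R]_3,
    X *m Phi c p *m Phi c p = - X + eval1 (eta c p) X *: xi c p;
  metric_Phi : forall (c : atlas M) p, dom c p -> forall X Y : 'rV[R]_3,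
    eval2 (metric c p) (X *m Phi c p) (Y *m Phi c p) =
    eval2 (metric c p) X Y + eval1 (eta c p) X * eval1 (eta c p) Y;
  deta_Phi : forall (c : atlas M) p, dom c p -> forall X Y : 'rV[R]_3,
    eval2 (ext_d eta c p) X Y = eval2 (metric c p) X (Y *m Phi c p)
}.

Section ContactDefs.
Variables (R : realType) (M : manifold R 3) (S : contact_metric_lorentzian M).
Implicit Types (c : atlas M) (p : M) (a : curve M).

Definition lorentzian_sasakian : Prop := killing (metric S) (xi S).

Definition vprod c p (X Y : 'rV[R]_3) : 'rV[R]_3 :=
  eval2 (metric S c p) X (Y *m Phi S c p) *: xi S c p
  - eval1 (eta S c p) Y *: (X *m Phi S c p)
  + eval1 (eta S c p) X *: (Y *m Phi S c p).

(* The contact magnetic field - q d eta of strength q. *)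
Definition contact_magnetic_field (q : R) c p : 'M[R]_3 :=
  - (q *: ext_d (eta S) c p).

(* The curve a is a non-geodesic Frenet curve with Frenet frame (T, N, B),
   where T is the velocity of a and e1, e2, e3 are the causal characters of
   T, N and B, with curvature kappa and torsion tau. *)
Record frenet_curve a (N B : vector_along a) (e1 e2 e3 : R)
    (kappa tau : R -> R) : Prop := FrenetCurve {
  frenet_e1 : e1 = 1 \/ e1 = -1;
  frenet_e2 : e2 = 1 \/ e2 = -1;
  frenet_e3 : e3 = 1 \/ e3 = -1;
  frenet_signs : e1 * e2 = - e3;
  frenet_kappa_gt0 : forall t, curve_dom a t -> 0 < kappa t;
  frenet_nonnull : forall c t, curve_dom a t -> dom c (a t) ->
    let A := cov_deriv (metric S) a (velocity a) c t in
    eval2 (metric S c (a t)) A A != 0;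
  frenet_orthonormal : forall c t, curve_dom a t -> dom c (a t) ->
    let g := eval2 (metric S c (a t)) in
    let T := velocity a c t in
    [/\ g T T = e1, g (N c t) (N c t) = e2 & g (B c t) (B c t) = e3] /\
    [/\ g T (N c t) = 0, g T (B c t) = 0 & g (N c t) (B c t) = 0];
  frenet_oriented : forall c t, curve_dom a t -> dom c (a t) ->
    let T := velocity a c t in
    [/\ vprod c (a t) T (N c t) = e3 *: B c t,
        vprod c (a t) (N c t) (B c t) = e1 *: T &
        vprod c (a t) (B c t) T = e2 *: N c t];
  frenet_equations : forall c t, curve_dom a t -> dom c (a t) ->
    let D (Y : atlas M -> R -> 'rV[R]_3) := cov_deriv (metric S) a Y c t in
    let T := velocity a c t in
    [/\ D (velocity a) = (e2 * kappa t) *: N c t,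
        D N = - ((e1 * kappa t) *: T) - (e3 * tau t) *: B c t &
        D B = (e2 * tau t) *: N c t]
}.

Definition contact_whirl a (N : vector_along a) : Prop :=
  exists2 rho : R, rho != 0 &
    forall c t, curve_dom a t -> dom c (a t) ->
      eval1 (eta S c (a t)) (velocity a c t) =
      rho * eval1 (eta S c (a t)) (N c t).

End ContactDefs.

(* Main.v *)
Require Import Defs.
From mathcomp Require Import all_boot all_order all_algebra.
From mathcomp Require Import all_classical all_reals all_analysis.
From mathcomp Require Import ring.
Import Order.TTheory GRing.Theory Num.Theory.
Import numFieldNormedType.Exports.
Local Open Scope classical_set_scope.
Local Open Scope ring_scope.

(** The torsion can be read off from nabla_T B, because the binormal of such a
curve is a multiple of the Reeb field.

The Lorentz force of the contact magnetic field is q Phi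
([lorentz_force_Phi]), and eta o Phi = 0 ([eta_Phi]).  Applying eta to
epsilon_2 kappa N = nabla_T T = q Phi T therefore gives eta(N) = 0, and the
whirl condition turns this into eta(T) = 0: the curve is Legendre with a
horizontal normal.  The vector product of two horizontal vectors is vertical
([vprod_horizontal]), so T /\ N = epsilon_3 B yields B = s xi with
s = eta(B).

In the Sasakian case nabla_X xi = Phi X ([sasakian_nabla_xi]), hence
nabla_T B = s' xi + s Phi T.  On the other hand xi /\ T = Phi T
([xi_vprod]), so s Phi T = B /\ T = epsilon_2 N.  Comparing with the Frenet
equation nabla_T B = epsilon_2 tau N,
  s' xi + epsilon_2 N = epsilon_2 tau N.
Since eta(N) = 0, applying eta leaves s' = 0, and then tau = 1 because N is
not null.

The identity nabla_X xi = Phi X comes from a fact valid in every dimension: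
if X is Killing and omega = - g(X, .), the Koszul formula and the Killing
equation combine into g(nabla_Y X, Z) = - d omega(Y, Z) ([killing_nabla]).
The remaining analysis is the chain rule along the curve
([cov_deriv_scaled_field]). *)

Set Implicit Arguments.
Unset Strict Implicit.
Unset Printing Implicit Defensive.

(** * Pointwise bilinear algebra *)

Section Evaluation.
Variables (R : realType) (n : nat).
Implicit Types (w : 'cV[R]_n) (A : 'M[R]_n) (X Y : 'rV[R]_n) (k : R).

Lemma eval1Z w k X : eval1 w (k *: X) = k * eval1 w X.
Proof. by rewrite /eval1 -scalemxAl mxE. Qed.

Lemma eval1D w X Y : eval1 w (X + Y) = eval1 w X + eval1 w Y.
Proof. by rewrite /eval1 mulmxDl mxE. Qed.

Lemma eval2Dl A X X' Y : eval2 A (X + X') Y = eval2 A X Y + eval2 A X' Y.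
Proof. by rewrite /eval2 !mulmxDl mxE. Qed.

Lemma eval2Zl A k X Y : eval2 A (k *: X) Y = k * eval2 A X Y.
Proof. by rewrite /eval2 -!scalemxAl mxE. Qed.

Lemma eval2_suml A m (F : 'I_m -> 'rV[R]_n) Y :
  eval2 A (\sum_i F i) Y = \sum_i eval2 A (F i) Y.
Proof. by rewrite /eval2 !mulmx_suml summxE. Qed.

Lemma eval2C A X Y : A^T = A -> eval2 A X Y = eval2 A Y X.
Proof.
move=> AT; rewrite /eval2 -[in LHS](trmxK (X *m _ *m _)) mxE.
by rewrite !trmx_mul trmxK AT mulmxA.
Qed.

Lemma eval2_delta A X j : eval2 A X (delta_mx 0 j) = (X *m A) 0 j.
Proof. by rewrite /eval2 trmx_delta -colE mxE. Qed.

Lemma eval2_inj A X Y : A \in unitmx ->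
  (forall j, eval2 A X (delta_mx 0 j) = eval2 A Y (delta_mx 0 j)) -> X = Y.
Proof.
move=> Au XY; apply: (can_inj (mulmxK Au)); apply/rowP => j.
by have := XY j; rewrite !eval2_delta.
Qed.

End Evaluation.

(** * Covariant derivatives in a chart *)

Section ChartCalculus.
Variables (R : realType) (n : nat) (M : manifold R n).
Implicit Types (c : atlas M) (p : M).
Implicit Types (g : bilinear_field M) (X : vector_field M).

(** Coordinate derivatives are taken of [f \o icoord c], so an identity between
fields on the domain of [c] must be moved to a neighbourhood of [c p] before
it can be differentiated. *)
Lemma near_chart c p (P : M -> Prop) : dom c p ->
  (forall x, dom c x -> P x) -> \forall y \near c p, P (icoord c y).
Proof.
move=> cp HP; have Mcp : (c @` dom c) (c p) by exists p.
near=> y.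
have [x cx <-] : (c @` dom c) y.
  by near: y; apply: open_nbhs_nbhs; split=> //; exact: codom_open.
by rewrite coordK //; exact: HP.
Unshelve. all: by end_near. Qed.

Lemma differentiable_tensor (V : normedModType R) law
    (A : @tensor_field R n M V law) c p :
  dom c p -> differentiable (A c \o icoord c) (c p).
Proof.
by move=> cp; have [dA _] := comp_smooth A c 1%N; apply: dA; exists p.
Qed.

Lemma differentiable_entry (V : normedModType R) l m (f : V -> 'M[R]_(l, m))
    y i j : differentiable f y -> differentiable (fun x => f x i j) y.
Proof.
move=> df; apply: (@differentiable_comp _ _ _ _ f (fun A => A i j)) => //.
exact: differentiable_coord.
Qed.

Lemma pderiv_entry l m (f : M -> 'M[R]_(l, m)) c p k i j :
  differentiable (f \o icoord c) (c p) ->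
  pderiv c k f p i j = pderiv c k (fun x => f x i j) p.
Proof.
by move=> df; rewrite /pderiv derive_mx ?mxE//; exact: diff_derivable.
Qed.

Lemma derive1Z (s : R -> R) (Y : R -> 'rV[R]_n) t :
  derivable s t 1 -> derivable Y t 1 ->
  derive1 (fun u => s u *: Y u) t = derive1 s t *: Y t + s t *: derive1 Y t.
Proof.
move=> ds dY.
have E i j : (fun u => (s u *: Y u) i j) = s * (fun u => Y u i j).
  by apply/funext => u; rewrite mxE.
have /derivable_mxP dYij := dY.
apply/rowP => k; rewrite !derive1E derive_mx; last first.
  by apply/derivable_mxP => i j; rewrite E; exact: derivableM.
by rewrite [in RHS]derive_mx// !mxE E deriveM// addrC; congr (_ + _);
  exact: mulrC.
Qed.

Definition nabla g X c p (i : 'I_n) : 'rV[R]_n :=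
  pderiv c i (X c) p + \sum_j X c p 0 j *: christoffel g c p i j.

Lemma christoffel_lowered g c p i j l : lorentzian g -> dom c p ->
  eval2 (g c p) (christoffel g c p i j) (delta_mx 0 l) =
  2^-1 * (pderiv c i (fun x => g c x j l) p + pderiv c j (fun x => g c x i l) p
          - pderiv c l (fun x => g c x i j) p).
Proof.
move=> g_lor cp; rewrite eval2_delta /christoffel mulmxKV ?mxE//.
exact: lorentzian_unitmx.
Qed.

(** The Leibniz rule for omega_l = - sum_k g_lk X^k, the sign being that of
eta = - g(xi, .) for a timelike Reeb field. *)
Lemma pderiv_dual g X (w : one_form M) c p i l : dom c p ->
  (forall x, dom c x -> w c x = - (g c x *m (X c x)^T)) ->
  pderiv c i (fun x => w c x l 0) p =
  - \sum_k (pderiv c i (fun x => g c x l k) p * X c p 0 k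
            + g c p l k * pderiv c i (fun x => X c x 0 k) p).
Proof.
move=> cp wE.
pose G k : 'rV[R]_n -> R := fun y => g c (icoord c y) l k.
pose Z k : 'rV[R]_n -> R := fun y => X c (icoord c y) 0 k.
have dG k v : derivable (G k) (c p) v.
  apply: diff_derivable; apply: (@differentiable_entry _ _ _ (g c \o icoord c)).
  exact: differentiable_tensor.
have dZ k v : derivable (Z k) (c p) v.
  apply: diff_derivable; apply: (@differentiable_entry _ _ _ (X c \o icoord c)).
  exact: differentiable_tensor.
rewrite /pderiv.
rewrite (@near_eq_derive _ _ _ _ (- \sum_k (G k * Z k))); last first.
  near=> y; rewrite /= (near (near_chart cp wE) y)// !mxE fctE; congr (- _).
  rewrite fct_sumE.
  by apply: eq_bigr => k _; rewrite mxE.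
rewrite deriveN; last by apply: derivable_sum => k; exact: derivableM.
rewrite derive_sum; last by move=> k; exact: derivableM.
congr (- _); apply: eq_bigr => k _; rewrite deriveM//.
by rewrite /G /Z coordK// addrC [in X in _ = X + _]mulrC.
Unshelve. all: by end_near. Qed.

(** With omega = - g(X, .), half the Killing equation makes up the difference
between g(nabla_i X, d_l) and - d omega(d_i, d_l): the symmetric part of the
covariant derivative of X vanishes, and what is left is the exterior
derivative of its dual form. *)
Lemma killing_nabla g X (w : one_form M) c p i l :
  lorentzian g -> killing g X -> dom c p ->
  (forall x, dom c x -> w c x = - (g c x *m (X c x)^T)) ->
  eval2 (g c p) (nabla g X c p i) (delta_mx 0 l) = - ext_d w c p i l.
Proof.
move=> g_lor kX cp wE.
have gC k j : g c p k j = g c p j k.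
  by have [/matrixP/(_ j k)] := g_lor _ _ cp; rewrite mxE.
apply: subr0_eq; transitivity (2^-1 * lie_metric X g c p i l); last first.
  by rewrite kX// mxE mulr0.
rewrite eval2Dl eval2_suml eval2_delta !mxE !(pderiv_dual _ _ cp wE).
under [X in _ + X - _]eq_bigr do rewrite eval2Zl christoffel_lowered//.
rewrite opprK opprK (addrC (- _)) -sumrB !mulr_sumr -!big_split /=.
apply: eq_bigr => k _.
rewrite pderiv_entry; last exact: differentiable_tensor.
rewrite (gC l k) (pderiv_metric_sym i l k g_lor cp).
by field.
Qed.

Lemma near_curve (a : curve M) c t : curve_dom a t -> dom c (a t) ->
  \forall u \near t, curve_dom a u /\ dom c (a u).
Proof.
move=> at_ ct; near=> u; split; near: u.
  exact/open_nbhs_nbhs/(conj (@curve_dom_open _ _ _ a)).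
apply: (curve_cont at_).
exact/open_nbhs_nbhs/(conj (@dom_open _ _ _ c)).
Unshelve. all: by end_near. Qed.

Lemma derivable_along (a : curve M) (Y : vector_along a) c t :
  curve_dom a t -> dom c (a t) -> derivable (Y c) t 1.
Proof.
move=> at_ ct; apply/diff_derivable.
by have [dY _] := along_smooth Y c 1%N; exact: dY.
Qed.

(** The chain rule through the chart: near [t], f o a factors as
(f o c^-1) o (c o a). *)
Lemma derive1_comp_curve (a : curve M) (V : normedModType R) (f : M -> V) c t :
  curve_dom a t -> dom c (a t) ->
  differentiable (f \o icoord c) (c (a t)) ->
  derivable (f \o a) t 1 /\
  derive1 (f \o a) t = \sum_i velocity a c t 0 i *: pderiv c i f (a t).
Proof.
move=> at_ ct df.
have da : differentiable (c \o a) t.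
  by have [da _] := curve_smooth a c 1%N; apply: da.
have fa : {near t, (f \o icoord c) \o (c \o a) =1 f \o a}.
  near=> u; have [_ cu] : curve_dom a u /\ dom c (a u).
    by near: u; exact: near_curve.
  by rewrite /= coordK.
split.
  apply: near_eq_derivable fa _.
  exact/diff_derivable/differentiable_comp.
rewrite derive1E -(near_eq_derive _ fa) deriveE; last first.
  exact: differentiable_comp.
rewrite diff_comp//= -derive1E'//.
rewrite -/(velocity a c t) [in LHS](row_sum_delta (velocity a c t)) linear_sum.
by apply: eq_bigr => i _; rewrite linearZ /= /pderiv deriveE.
Unshelve. all: by end_near. Qed.

(** This allows a vector field along the curve to be replaced by an expression
for it that holds only while the curve stays in one chart. *)
Lemma near_eq_cov_deriv g (a : curve M) (Y Z : atlas M -> R -> 'rV[R]_n) c t :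
  (\forall u \near t, Y c u = Z c u) ->
  cov_deriv g a Y c t = cov_deriv g a Z c t.
Proof.
move=> YZ; rewrite /cov_deriv !derive1E (near_eq_derive _ YZ).
by rewrite (nbhs_singleton YZ).
Qed.

(** nabla_T (s X) = s' X + s nabla_T X for an ambient field X, with nabla_T X
computed from the values of nabla X on the coordinate fields. *)
Lemma cov_deriv_scaled_field g X (a : curve M) (s : R -> R) c t :
  curve_dom a t -> dom c (a t) -> derivable s t 1 ->
  cov_deriv g a (fun d u => s u *: X d (a u)) c t =
  derive1 s t *: X c (a t)
  + s t *: \sum_i velocity a c t 0 i *: nabla g X c (a t) i.
Proof.
move=> at_ ct ds.
have [dX X'] := derive1_comp_curve at_ ct (differentiable_tensor X ct).
rewrite /cov_deriv derive1Z// X' /nabla -addrA; congr (_ + _).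
rewrite !scaler_sumr -big_split /=; apply: eq_bigr => i _.
rewrite !scalerDr !scaler_sumr; congr (_ + _); apply: eq_bigr => j _.
by rewrite mxE !scalerA mulrCA mulrA.
Qed.

Lemma ext_dC (w : one_form M) c p Y Z :
  eval2 (ext_d w c p) Y Z = - eval2 (ext_d w c p) Z Y.
Proof.
have dT : (ext_d w c p)^T = - ext_d w c p.
  by apply/matrixP => i j; rewrite !mxE -mulrN opprB.
rewrite /eval2 -[in LHS](trmxK (Y *m _ *m _)) mxE.
by rewrite !trmx_mul trmxK dT mulNmx mulmxN mxE mulmxA.
Qed.

End ChartCalculus.

(** * Contact metric and Sasakian identities *)

Section ContactMetric.
Variables (R : realType) (M : manifold R 3) (S : contact_metric_lorentzian M).
Variables (c : atlas M) (p : M).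
Hypothesis cp : dom c p.
Local Notation g := (eval2 (metric S c p)).

Lemma metric_unit : metric S c p \in unitmx.
Proof. exact: lorentzian_unitmx (metric_lorentzian S) cp. Qed.

Lemma metricC X Y : g X Y = g Y X.
Proof. by apply: eval2C; have [] := metric_lorentzian S cp. Qed.

(** By g(X, Phi xi) = d eta(X, xi) = 0 and nondegeneracy of g. *)
Lemma xi_Phi : xi S c p *m Phi S c p = 0.
Proof.
apply: (eval2_inj metric_unit) => j.
rewrite metricC -deta_Phi// ext_dC deta_xi// oppr0.
by rewrite /eval2 !mul0mx mxE.
Qed.

(** This is the compatibility of g with Phi at (X, xi), as Phi xi = 0. *)
Lemma eta_metric X : eval1 (eta S c p) X = - g X (xi S c p).
Proof.
apply/eqP; rewrite eq_sym -subr_eq0 -opprD oppr_eq0.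
have := metric_Phi S cp X (xi S c p); rewrite xi_Phi eta_xi// mulr1 => <-.
by rewrite /eval2 trmx0 mulmx0 mxE.
Qed.

(** The component form of [eta_metric], as required by [killing_nabla]. *)
Lemma eta_dual : eta S c p = - (metric S c p *m (xi S c p)^T).
Proof.
apply/colP => k; have := eta_metric (delta_mx 0 k).
by rewrite /eval1 /eval2 -mulmxA -!rowE !mxE.
Qed.

(** Because eta(Phi X) = - g(xi, Phi X) = - d eta(xi, X). *)
Lemma eta_Phi X : eval1 (eta S c p) (X *m Phi S c p) = 0.
Proof. by rewrite eta_metric metricC -deta_Phi// deta_xi// oppr0. Qed.

(** The force is determined by nondegeneracy of g, and
- q d eta(X, Y) = q d eta(Y, X) = q g(Phi X, Y). *)
Lemma lorentz_force_Phi q (phi : endo_field M) (X : 'rV[R]_3) :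
  lorentz_force (metric S) (contact_magnetic_field S q) phi ->
  X *m phi c p = q *: (X *m Phi S c p).
Proof.
move=> Hphi; apply: (eval2_inj metric_unit) => j.
rewrite Hphi// eval2Zl metricC -deta_Phi// ext_dC.
rewrite /contact_magnetic_field /eval2 mulmxN -scalemxAr mulNmx -scalemxAl.
by rewrite !mxE mulrN.
Qed.

Lemma xi_vprod X : eval1 (eta S c p) X = 0 ->
  vprod S c p (xi S c p) X = X *m Phi S c p.
Proof.
move=> X0; rewrite /vprod -deta_Phi// deta_xi// X0 eta_xi//.
by rewrite !scale0r subr0 add0r scale1r.
Qed.

End ContactMetric.

Lemma vprod_horizontal (R : realType) (M : manifold R 3)
    (S : contact_metric_lorentzian M) (c : atlas M) (p : M) X Y :
  eval1 (eta S c p) X = 0 -> eval1 (eta S c p) Y = 0 ->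
  vprod S c p X Y = eval2 (metric S c p) X (Y *m Phi S c p) *: xi S c p.
Proof. by move=> X0 Y0; rewrite /vprod X0 Y0 !scale0r subr0 addr0. Qed.

Lemma vprodZl (R : realType) (M : manifold R 3)
    (S : contact_metric_lorentzian M) (c : atlas M) (p : M) k X Y :
  vprod S c p (k *: X) Y = k *: vprod S c p X Y.
Proof.
rewrite /vprod eval2Zl eval1Z -scalemxAl !scalerDr scalerN !scalerA.
by rewrite [k * eval1 _ Y]mulrC.
Qed.

(** Apply [killing_nabla] to omega = eta: g(nabla_X xi, Y) = - d eta(X, Y)
= d eta(Y, X) = g(Phi X, Y). *)
Lemma sasakian_nabla_xi (R : realType) (M : manifold R 3)
    (S : contact_metric_lorentzian M) (c : atlas M) (p : M) i :
  lorentzian_sasakian S -> dom c p ->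
  nabla (metric S) (xi S) c p i = row i (Phi S c p).
Proof.
move=> hS cp; have g_lor := metric_lorentzian S.
apply: (eval2_inj (lorentzian_unitmx g_lor cp)) => j.
rewrite (killing_nabla i j g_lor hS cp (@eta_dual _ _ S c)).
rewrite rowE metricC// -deta_Phi// ext_dC.
by rewrite /eval2 trmx_delta -rowE -colE !mxE.
Qed.

(** * Magnetic whirl curves *)

Unset Implicit Arguments.

Theorem corollary3p11 (R : realType) (M : manifold R 3)
    (S : contact_metric_lorentzian M) (a : curve M)
    (N B : vector_along a) (e1 e2 e3 : R) (kappa tau : R -> R) (q : R)
    (hS : lorentzian_sasakian S)
    (ha : frenet_curve S N B e1 e2 e3 kappa tau)
    (hq : q != 0)
    (hmag : magnetic_trajectory (metric S) (contact_magnetic_field S q) a)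
    (hwhirl : contact_whirl S N) :
  forall t : R, curve_dom a t -> tau t = 1.
Proof.
have sign_neq0 (e : R) : e = 1 \/ e = -1 -> e != 0.
  by case=> ->; rewrite ?oppr_eq0 oner_neq0.
have e2_neq0 := sign_neq0 _ (frenet_e2 ha).
have e3_neq0 := sign_neq0 _ (frenet_e3 ha).
(* eta kills both sides of epsilon_2 kappa N = q Phi T. *)
have etaN (c : atlas M) t : curve_dom a t -> dom c (a t) ->
    eval1 (eta S c (a t)) (N c t) = 0.
  move=> at_ ct; have [phi Hphi Hmag] := hmag.
  have [DT _ _] := frenet_equations ha at_ ct.
  have := congr1 (eval1 (eta S c (a t))) DT.
  rewrite Hmag// (lorentz_force_Phi ct _ Hphi) !eval1Z eta_Phi// mulr0.
  move/esym/eqP; rewrite !mulf_eq0 (negPf e2_neq0).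
  by rewrite gt_eqF ?(frenet_kappa_gt0 ha)// => /eqP.
have etaT (c : atlas M) t : curve_dom a t -> dom c (a t) ->
    eval1 (eta S c (a t)) (velocity a c t) = 0.
  by move=> at_ ct; have [rho _ ->] := hwhirl; rewrite ?etaN ?mulr0.
have B_xi (c : atlas M) t : curve_dom a t -> dom c (a t) ->
    B c t = eval1 (eta S c (a t)) (B c t) *: xi S c (a t).
  move=> at_ ct; have [TN _ _] := frenet_oriented ha at_ ct.
  move: TN; rewrite vprod_horizontal ?etaT ?etaN//.
  move=> /(congr1 ( *:%R e3^-1)); rewrite scalerK// => <-.
  by rewrite scalerA eval1Z eta_xi// mulr1.
move=> t at_; have [c ct] := atlas_cover (a t).
(* The factor s is smooth as the pairing of the smooth eta and B; that it is
   locally constant is obtained below from the Frenet equation for B. *)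
pose s u := eval1 (eta S c (a u)) (B c u).
have ds : derivable s t 1.
  pose b k u := B c u 0 k; pose h k u := eta S c (a u) k 0.
  have -> : s = \sum_k (b k * h k).
    by apply/funext => u; rewrite /s /eval1 mxE fct_sumE.
  apply: derivable_sum => k; apply: derivableM.
    by have /derivable_mxP := @derivable_along _ _ _ _ B _ _ at_ ct; apply.
  have [dh _] := derive1_comp_curve at_ ct (differentiable_tensor (eta S) ct).
  by have /derivable_mxP := dh; apply.
have nearB : \forall u \near t, B c u = s u *: xi S c (a u).
  by near=> u; have [] := near (near_curve at_ ct) u => // *; exact: B_xi.
have DB : cov_deriv (metric S) a B c t =
    derive1 s t *: xi S c (a t) + s t *: (velocity a c t *m Phi S c (a t)).
  rewrite (@near_eq_cov_deriv _ _ _ (metric S) a (along B)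
    (fun d u => s u *: xi S d (a u)) c t nearB).
  rewrite cov_deriv_scaled_field// mulmx_sum_row.
  by under eq_bigr do rewrite sasakian_nabla_xi//.
have [_ _ BT] := frenet_oriented ha at_ ct.
have [_ _ DB'] := frenet_equations ha at_ ct.
rewrite (B_xi _ _ at_ ct) vprodZl xi_vprod ?etaT// -/(s t) in BT.
(* s' xi + epsilon_2 N = epsilon_2 tau N, whose vertical part is s'. *)
rewrite DB BT in DB'.
have s'0 : derive1 s t = 0.
  have := congr1 (eval1 (eta S c (a t))) DB'.
  by rewrite eval1D !eval1Z etaN// !mulr0 addr0 eta_xi// mulr1.
have N_neq0 : N c t != 0.
  have [[_ NN _] _] := frenet_orthonormal ha at_ ct.
  apply/eqP => N0; move: NN e2_neq0; rewrite N0 /eval2 !mul0mx mxE => <-.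
  by rewrite eqxx.
move: DB'; rewrite s'0 scale0r add0r => /eqP.
rewrite -subr_eq0 -scalerBl scaler_eq0 (negPf N_neq0) orbF -{1}(mulr1 e2).
by rewrite -mulrBr mulf_eq0 (negPf e2_neq0) subr_eq0 => /eqP.
Unshelve. all: by end_near. Qed.
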